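(* Each sorted modal companion logic $\mathbf{sub.ML}_2$ ($\mathbf{nfl.ML}_2,\mathbf{fl.ML}_2,\mathbf{bci.ML}_2,\mathbf{bck.ML}_2,\mathbf{bcw.ML}_2$) is sound in the corresponding frame class ($\mathbb{NFL},\mathbb{FL},\mathbb{BCI},\mathbb{BCK},\mathbb{BCW}$ respectively).
   Context: Frames $(X,\perp,Y,R)$: $X,Y$ nonempty, $\perp\subseteq X\times Y$ with complement $I$ satisfying: every $x$ has some $y$ with $xIy$ and every $y$ has some $x$ with $xIy$; $R\subseteq X^3$; $x\preceq z$ iff $\forall y(x\perp y\to z\perp y)$. Constraints (C1) $\exists x(xRuv\wedge zRxw)$ iff $\exists x(xRvw\wedge zRux)$; (C2) $xRzz'\leftrightarrow xRz'z$; (C3) $xRzz'\to z'\preceq x$; (C4) $xRxx$. Classes: $\mathbb{NFL}$ all, $\mathbb{FL}$ (C1), $\mathbb{BCI}$ (C1,C2), $\mathbb{BCK}$ (C1–C3), $\mathbb{BCW}$ (C1,C2,C4). Language: sort 1 $\alpha::=P_i\mid\neg\alpha\mid\alpha\wedge\alpha\mid\Box_1\beta\mid\alpha\odot\alpha\mid\alpha\leftharpoonup\alpha\mid\alpha\rightharpoonup\alpha$; sort 2 $\beta::=Q_i\mid\neg\beta\mid\beta\wedge\beta\mid\Box_2\alpha$; $\Diamond_1\beta:=\neg\Box_1\neg\beta$, $\Diamond_2\alpha:=\neg\Box_2\neg\alpha$. Semantics: classical per sort; $x\models\alpha\odot\alpha'$ iff $\exists z,z'(xRzz'\wedge z\models\alpha\wedge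 z'\models\alpha')$; $x\models\alpha\rightharpoonup\alpha'$ iff $\forall z,z'(z\models\alpha\wedge z'Rzx\to z'\models\alpha')$; $x\models\alpha'\leftharpoonup\alpha$ iff $\forall z,z'(z\models\alpha\wedge z'Rxz\to z'\models\alpha')$; $x\models\Box_1\beta$ iff $\forall y(xIy\to y\models\beta)$; $y\models\Box_2\alpha$ iff $\forall x(xIy\to x\models\alpha)$. Proof systems: $\mathbf{ML}_2$ = classical logic per sort plus $\alpha\vdash_1\Box_1\Diamond_2\alpha$, $\Diamond_2\Box_1\beta\vdash_2\beta$, $\Box_1\beta\vdash_1\Diamond_1\beta$, $\Box_2\alpha\vdash_2\Diamond_2\alpha$, $\top\vdash_1\Box_1{\tt t}$, ${\tt t}\vdash_2\Box_2\top$, monotonicity rules for $\Box_1,\Box_2$ and their preservation of $\wedge$. $\mathbf{nfl.ML}_2$ adds monotonicity and residuation for $\odot,\rightharpoonup,\leftharpoonup$ ($\alpha\odot(\alpha\rightharpoonup\alpha')\vdash_1\alpha'$, $\alpha'\vdash_1\alpha\rightharpoonup(\alpha\odot\alpha')$, $\alpha'\vdash_1(\alpha'\odot\alpha)\leftharpoonup\alpha$, $(\alpha'\leftharpoonup\alpha)\odot\alpha\vdash_1\alpha'$); $\mathbf{fl.ML}_2$ adds associativity of $\odot$; $\mathbf{bci.ML}_2$ adds $\alpha\odot\alpha'\vdash_1\alpha'\odot\alpha$; $\mathbf{bcw.ML}_2=\mathbf{bci.ML}_2+\alpha\wedge\alpha'\vdash_1\alpha\odot\alpha'$; $\mathbf{bck.ML}_2=\mathbf{bci.ML}_2+\Box_1\beta\odot\Box_1\beta'\vdash_1\Box_1\beta'$.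 *)

(* Defs.v *)
(** Sorted residuated frames, the two-sorted modal language with a residuated
    binary operator on the first sort, and the proof systems
    [nfl.ML_2], [fl.ML_2], [bci.ML_2], [bck.ML_2], [bcw.ML_2]. *)

Record frame : Type := Frame {
  pX : Type;
  pY : Type;
  perp : pX -> pY -> Prop;
  R : pX -> pX -> pX -> Prop;
  pX_inh : inhabited pX;
  pY_inh : inhabited pY;
  compl_serial_l : forall x : pX, exists y : pY, ~ perp x y;
  compl_serial_r : forall y : pY, exists x : pX, ~ perp x y
}.

Arguments perp {f} _ _.
Arguments R {f} _ _ _.

Definition I {F : frame} (x : pX F) (y : pY F) : Prop := ~ perp x y.

Definition preceq {F : frame} (x z : pX F) : Prop :=
  forall y : pY F, perp x y -> perp z y.

Definition C1 (F : frame) : Prop :=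
  forall z u v w : pX F,
    (exists x, R x u v /\ R z x w) <-> (exists x, R x v w /\ R z u x).

Definition C2 (F : frame) : Prop :=
  forall x z z' : pX F, R x z z' <-> R x z' z.

Definition C3 (F : frame) : Prop :=
  forall x z z' : pX F, R x z z' -> preceq z' x.

Definition C4 (F : frame) : Prop :=
  forall x : pX F, R x x x.

Inductive sublogic : Set := nfl | fl | bci | bck | bcw.

Definition frame_class (L : sublogic) (F : frame) : Prop :=
  match L with
  | nfl => True
  | fl => C1 F
  | bci => C1 F /\ C2 F
  | bck => C1 F /\ C2 F /\ C3 F
  | bcw => C1 F /\ C2 F /\ C4 F
  end.

(** [LRes a' a] is a' ↼ a, and [RRes a a'] is a ⇀ a': in both cases the
    arguments are in the order in which the connective is written. *)
Inductive form1 : Set :=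
  | P (i : nat)
  | Neg1 (a : form1)
  | And1 (a a' : form1)
  | Box1 (b : form2)
  | Fuse (a a' : form1)
  | LRes (a' a : form1)
  | RRes (a a' : form1)
with form2 : Set :=
  | Q (i : nat)
  | Neg2 (b : form2)
  | And2 (b b' : form2)
  | Box2 (a : form1).

Definition Dia1 (b : form2) : form1 := Neg1 (Box1 (Neg2 b)).
Definition Dia2 (a : form1) : form2 := Neg2 (Box2 (Neg1 a)).

(** Truth constants are not primitive in the language. *)
Definition Top1 : form1 := Neg1 (And1 (P 0) (Neg1 (P 0))).
Definition Top2 : form2 := Neg2 (And2 (Q 0) (Neg2 (Q 0))).

Record valuation (F : frame) : Type := Valuation {
  val1 : nat -> pX F -> Prop;
  val2 : nat -> pY F -> Prop
}.

Arguments val1 {F} _ _ _.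
Arguments val2 {F} _ _ _.

Fixpoint sat1 {F : frame} (V : valuation F) (a : form1) (x : pX F) {struct a}
  : Prop :=
  match a with
  | P i => val1 V i x
  | Neg1 a => ~ sat1 V a x
  | And1 a a' => sat1 V a x /\ sat1 V a' x
  | Box1 b => forall y : pY F, I x y -> sat2 V b y
  | Fuse a a' =>
      exists z z' : pX F, R x z z' /\ sat1 V a z /\ sat1 V a' z'
  | LRes a' a =>
      forall z z' : pX F, sat1 V a z /\ R z' x z -> sat1 V a' z'
  | RRes a a' =>
      forall z z' : pX F, sat1 V a z /\ R z' z x -> sat1 V a' z'
  end
with sat2 {F : frame} (V : valuation F) (b : form2) (y : pY F) {struct b}
  : Prop :=
  match b with
  | Q i => val2 V i y
  | Neg2 b => ~ sat2 V b y
  | And2 b b' => sat2 V b y /\ sat2 V b' y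
  | Box2 a => forall x : pX F, I x y -> sat1 V a x
  end.

Inductive assoc_ax : form1 -> form1 -> Prop :=
  | assoc_lr a b c : assoc_ax (Fuse (Fuse a b) c) (Fuse a (Fuse b c))
  | assoc_rl a b c : assoc_ax (Fuse a (Fuse b c)) (Fuse (Fuse a b) c).

Inductive exchange_ax : form1 -> form1 -> Prop :=
  | exchange a a' : exchange_ax (Fuse a a') (Fuse a' a).

Inductive weakening_ax : form1 -> form1 -> Prop :=
  | weakening b b' : weakening_ax (Fuse (Box1 b) (Box1 b')) (Box1 b').

Inductive contraction_ax : form1 -> form1 -> Prop :=
  | contraction a a' : contraction_ax (And1 a a') (Fuse a a').

Definition extra_ax (L : sublogic) (a a' : form1) : Prop :=
  match L with
  | nfl => False
  | fl => assoc_ax a a'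
  | bci => assoc_ax a a' \/ exchange_ax a a'
  | bck => assoc_ax a a' \/ exchange_ax a a' \/ weakening_ax a a'
  | bcw => assoc_ax a a' \/ exchange_ax a a' \/ contraction_ax a a'
  end.

(** Derivability of the single-premise sequents [a ⊢_1 a'] and [b ⊢_2 b'] in
    [L.ML_2].  In each sort the first seven rules axiomatize classical
    propositional logic in negation and conjunction. *)
Inductive derives1 (L : sublogic) : form1 -> form1 -> Prop :=
  | id1 a : derives1 L a a
  | cut1 a b c : derives1 L a b -> derives1 L b c -> derives1 L a c
  | andEl1 a b : derives1 L (And1 a b) a
  | andEr1 a b : derives1 L (And1 a b) b
  | andI1 c a b : derives1 L c a -> derives1 L c b -> derives1 L c (And1 a b)
  | negI1 c a b :
      derives1 L (And1 c a) (And1 b (Neg1 b)) -> derives1 L c (Neg1 a)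
  | dne1 a : derives1 L (Neg1 (Neg1 a)) a
  | unit1 a : derives1 L a (Box1 (Dia2 a))
  | serial1 b : derives1 L (Box1 b) (Dia1 b)
  | boxT1 : derives1 L Top1 (Box1 Top2)
  | box_mono1 b b' : derives2 L b b' -> derives1 L (Box1 b) (Box1 b')
  | box_and1 b b' :
      derives1 L (And1 (Box1 b) (Box1 b')) (Box1 (And2 b b'))
  | box_and_inv1 b b' :
      derives1 L (Box1 (And2 b b')) (And1 (Box1 b) (Box1 b'))
  | fuse_mono a b a' b' :
      derives1 L a b -> derives1 L a' b' ->
      derives1 L (Fuse a a') (Fuse b b')
  | rres_mono a b a' b' :
      derives1 L b a -> derives1 L a' b' ->
      derives1 L (RRes a a') (RRes b b')
  | lres_mono a b a' b' :
      derives1 L b a -> derives1 L a' b' ->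
      derives1 L (LRes a' a) (LRes b' b)
  | rres_counit a a' : derives1 L (Fuse a (RRes a a')) a'
  | rres_unit a a' : derives1 L a' (RRes a (Fuse a a'))
  | lres_unit a a' : derives1 L a' (LRes (Fuse a' a) a)
  | lres_counit a a' : derives1 L (Fuse (LRes a' a) a) a'
  | extra a a' : extra_ax L a a' -> derives1 L a a'
with derives2 (L : sublogic) : form2 -> form2 -> Prop :=
  | id2 a : derives2 L a a
  | cut2 a b c : derives2 L a b -> derives2 L b c -> derives2 L a c
  | andEl2 a b : derives2 L (And2 a b) a
  | andEr2 a b : derives2 L (And2 a b) b
  | andI2 c a b : derives2 L c a -> derives2 L c b -> derives2 L c (And2 a b)
  | negI2 c a b :
      derives2 L (And2 c a) (And2 b (Neg2 b)) -> derives2 L c (Neg2 a)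
  | dne2 a : derives2 L (Neg2 (Neg2 a)) a
  | counit2 b : derives2 L (Dia2 (Box1 b)) b
  | serial2 a : derives2 L (Box2 a) (Dia2 a)
  | boxT2 : derives2 L Top2 (Box2 Top1)
  | box_mono2 a a' : derives1 L a a' -> derives2 L (Box2 a) (Box2 a')
  | box_and2 a a' :
      derives2 L (And2 (Box2 a) (Box2 a')) (Box2 (And1 a a'))
  | box_and_inv2 a a' :
      derives2 L (Box2 (And1 a a')) (And2 (Box2 a) (Box2 a')).

Definition valid1 (F : frame) (a a' : form1) : Prop :=
  forall (V : valuation F) (x : pX F), sat1 V a x -> sat1 V a' x.

Definition valid2 (F : frame) (b b' : form2) : Prop :=
  forall (V : valuation F) (y : pY F), sat2 V b y -> sat2 V b' y.

Definition sound (L : sublogic) (K : frame -> Prop) : Prop :=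
  (forall a a' : form1, derives1 L a a' ->
     forall F : frame, K F -> valid1 F a a') /\
  (forall b b' : form2, derives2 L b b' ->
     forall F : frame, K F -> valid2 F b b').

(* Main.v *)
Require Import Defs.
From Stdlib Require Import Classical.

(* Fix a frame in the class and induct on derivations in both sorts at once, since [box_mono1] and
   [box_mono2] pass between them. [Box1] and [Box2] are the boxes of [I] and of its converse, hence
   [unit1] and [counit2] hold as in tense logic; seriality of [I] gives [serial1] and [serial2].
   [RRes] and [LRes] are the residuals of the operator that [R] induces. Each extra axiom of [L]
   follows from one frame condition, as collected in [extra_ax_valid]. *)
Scheme derives1_mut := Induction for derives1 Sort Prop
  with derives2_mut := Induction for derives2 Sort Prop.
Combined Scheme derives_mutind from derives1_mut, derives2_mut.

(** Either bracketing asks for points [u], [v], [w] composing to [x] through an intermediate point;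
    [C1] trades one intermediate point for the other. *)
Lemma assoc_ax_valid (F : frame) (a a' : form1) :
  C1 F -> assoc_ax a a' -> valid1 F a a'.
Proof.
  intros HC [b c d | b c d] V x; simpl.
  - intros (s & w & Hs & (u & v & Hu & Hb & Hc) & Hd).
    destruct (proj1 (HC x u v w)) as (t & Ht & Hx); eauto 10.
  - intros (u & s & Hs & Hb & v & w & Hv & Hc & Hd).
    destruct (proj2 (HC x u v w)) as (t & Ht & Hx); eauto 10.
Qed.

Lemma exchange_ax_valid (F : frame) (a a' : form1) :
  C2 F -> exchange_ax a a' -> valid1 F a a'.
Proof.
  intros HC [b c] V x (z & z' & HR & Hz & Hz').
  exists z', z. split; [apply HC | split]; assumption.
Qed.

(** The axiom is confined to boxed formulas because their truth sets are closed upwards under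
    [preceq]: when [preceq z' x], every [y] with [I x y] also has [I z' y]. *)
Lemma weakening_ax_valid (F : frame) (a a' : form1) :
  C3 F -> weakening_ax a a' -> valid1 F a a'.
Proof.
  intros HC [b b'] V x (z & z' & HR & _ & Hz') y HI.
  apply Hz'. intro Hperp. exact (HI (HC x z z' HR y Hperp)).
Qed.

Lemma contraction_ax_valid (F : frame) (a a' : form1) :
  C4 F -> contraction_ax a a' -> valid1 F a a'.
Proof.
  intros HC [b c] V x [Hb Hc]. exists x, x. auto.
Qed.

Lemma extra_ax_valid (L : sublogic) (F : frame) (a a' : form1) :
  frame_class L F -> extra_ax L a a' -> valid1 F a a'.
Proof.
  destruct L; simpl; intros HF Hax; intuition auto using
    assoc_ax_valid, exchange_ax_valid, weakening_ax_valid, contraction_ax_valid.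
Qed.

Lemma derives_valid (L : sublogic) (F : frame) :
  frame_class L F ->
  (forall a a' : form1, derives1 L a a' -> valid1 F a a') /\
  (forall b b' : form2, derives2 L b b' -> valid2 F b b').
Proof.
  intro HF.
  apply (derives_mutind L
    (fun a a' _ => valid1 F a a') (fun b b' _ => valid2 F b b'));
    unfold valid1, valid2; simpl.
  - auto.
  - eauto.
  - tauto.
  - tauto.
  - auto.
  - intros c a b _ IH V x Hc Ha. destruct (IH V x (conj Hc Ha)). contradiction.
  - intros a V x. apply NNPP.
  (* The point [x] itself witnesses [Dia2 a] at each [y] with [I x y]. *)
  - intros a V x Ha y HI Hn. exact (Hn x HI Ha).
  - intros b V x Hb Hn. destruct (compl_serial_l F x) as [y HI].
    exact (Hn y HI (Hb y HI)).
  - tauto.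
  - eauto.
  - intros b b' V x [Hb Hb'] y HI. auto.
  - intros b b' V x H. split; intros y HI; apply (H y HI).
  - intros a b a' b' _ IH _ IH' V x (z & z' & HR & Hz & Hz'). eauto 10.
  - intros a b a' b' _ IH _ IH' V x H z z' [Hz HR]. eauto.
  - intros a b a' b' _ IH _ IH' V x H z z' [Hz HR]. eauto.
  - intros a a' V x (z & z' & HR & Hz & Hz'). eauto.
  - intros a a' V x Ha z z' [Hz HR]. eauto 10.
  - intros a a' V x Ha z z' [Hz HR]. eauto 10.
  - intros a a' V x (z & z' & HR & Hz & Hz'). eauto.
  - intros a a' Hax. exact (extra_ax_valid L F a a' HF Hax).
  - auto.
  - eauto.
  - tauto.
  - tauto.
  - auto.
  - intros c a b _ IH V y Hc Ha. destruct (IH V y (conj Hc Ha)). contradiction.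
  - intros b V y. apply NNPP.
  (* [Dia2] is a negated box and yields no explicit witness, so the argument is classical: if [b]
     fails at [y], then every [x] with [I x y] refutes [Box1 b]. *)
  - intros b V y Hn. apply NNPP. intro Hb. apply Hn.
    intros x HI Hbox. exact (Hb (Hbox y HI)).
  - intros a V y Ha Hn. destruct (compl_serial_r F y) as [x HI].
    exact (Hn x HI (Ha x HI)).
  - tauto.
  - eauto.
  - intros a a' V y [Ha Ha'] x HI. auto.
  - intros a a' V y H. split; intros x HI; apply (H x HI).
Qed.

Theorem theorem3p4 (L : sublogic) : sound L (frame_class L).
Proof.
  split.
  - intros a a' Hd F HF. exact (proj1 (derives_valid L F HF) a a' Hd).
  - intros b b' Hd F HF. exact (proj2 (derives_valid L F HF) b b' Hd).
Qed.
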